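(* Let $D$ be a GMPD domain with $|\mathcal{O}(D)|<\infty$. Then $$|\mathcal{O}_{ql}(D)|=\sum_{M\in \operatorname{Max}(D)}|\mathcal{O}(D_{M})|-|\operatorname{Max}(D)|+1.$$
   Context: All rings are commutative unitary integral domains. A ring is quasi-local if it has exactly one maximal ideal (no Noetherian assumption). For an integral domain $D$ with quotient field $K$, an overring of $D$ is a subring of $K$ containing $D$; $\mathcal{O}(D)$ is the set of all overrings of $D$ and $\mathcal{O}_{ql}(D)$ is the set of those overrings of $D$ which are quasi-local. $\operatorname{Max}(D)$ is the set of maximal ideals of $D$. $D$ is h-local if each nonzero ideal of $D$ is contained in only finitely many maximal ideals and each nonzero prime ideal is contained in a unique maximal ideal. An MNI ideal of $D$ is an ideal of $D$ which is maximal (under inclusion) among the non-invertible ideals of $D$ (the zero ideal counts as non-invertible). $D$ is an MPD domain if it has a unique MNI ideal $Q$ and every nonzero non-invertible ideal of $D$ can be written as $JQ$ for some invertible ideal $J$ of $D$. $D$ is a GMPD domain (globalized multiplicatively pinched-Dedekind domain) if $D$ is h-local and the localization $D_M$ is an MPD domain for every maximal ideal $M$ of $D$. *)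

(* Defs.v *)
From HB Require Import structures.
From mathcomp Require Import all_boot all_order all_algebra finmap.
From mathcomp Require Import boolp classical_sets functions cardinality fsbigop.

Set Implicit Arguments.
Unset Strict Implicit.
Unset Printing Implicit Defensive.

Import GRing.Theory.
Local Open Scope classical_set_scope.
Local Open Scope ring_scope.

(* An integral domain with quotient field K is represented as a subring of the
   field K; its overrings, ideals and fractional ideals are subsets of K. *)

Definition subring (K : fieldType) (A : set K) : Prop :=
  GRing.subring_closed [in A].

Definition has_quotient_field (K : fieldType) (A : set K) : Prop :=
  forall x : K, exists a b : K, [/\ A a, A b, b != 0 & x = a / b].

Definition submodule (K : fieldType) (A I : set K) : Prop :=
  GRing.zmod_closed [in I] /\ (forall a x : K, A a -> I x -> I (a * x)).

Definition ideal (K : fieldType) (A I : set K) : Prop :=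
  submodule A I /\ I `<=` A.

Definition fractional_ideal (K : fieldType) (A J : set K) : Prop :=
  submodule A J /\
  (exists d : K, [/\ A d, d != 0 & forall x : K, J x -> A (d * x)]).

Definition mod_prod (K : fieldType) (I J : set K) : set K :=
  [set x | exists (n : nat) (a b : 'I_n -> K),
     (forall i, I (a i) /\ J (b i)) /\ x = \sum_(i < n) a i * b i].

Definition invertible_ideal (K : fieldType) (A I : set K) : Prop :=
  exists J : set K, fractional_ideal A J /\ mod_prod I J = A.

Definition prime_ideal (K : fieldType) (A P : set K) : Prop :=
  [/\ ideal A P, P != A &
      forall a b : K, A a -> A b -> P (a * b) -> P a \/ P b].

Definition maximal_among (K : fieldType) (F : set (set K)) : set (set K) :=
  [set M | F M /\ forall I : set K, F I -> M `<=` I -> I = M].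

Definition Max (K : fieldType) (A : set K) : set (set K) :=
  maximal_among [set I | ideal A I /\ I != A].

Definition MNI (K : fieldType) (A : set K) : set (set K) :=
  maximal_among [set I | ideal A I /\ ~ invertible_ideal A I].

Definition h_local (K : fieldType) (A : set K) : Prop :=
  (forall I : set K, ideal A I -> I != [set 0] ->
     finite_set [set M | Max A M /\ I `<=` M]) /\
  (forall P : set K, prime_ideal A P -> P != [set 0] ->
     exists! M : set K, Max A M /\ P `<=` M).

Definition localization (K : fieldType) (A M : set K) : set K :=
  [set x | exists a s : K, [/\ A a, A s, ~ M s & x = a / s]].

Definition MPD (K : fieldType) (A : set K) : Prop :=
  exists Q : set K,
    [/\ MNI A Q,
        forall Q' : set K, MNI A Q' -> Q' = Q &
        forall I : set K, ideal A I -> I != [set 0] -> ~ invertible_ideal A I ->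
          exists J : set K, [/\ ideal A J, invertible_ideal A J & I = mod_prod J Q]].

Definition GMPD (K : fieldType) (A : set K) : Prop :=
  h_local A /\ (forall M : set K, Max A M -> MPD (localization A M)).

Definition quasi_local (K : fieldType) (A : set K) : Prop :=
  exists! M : set K, Max A M.

(* Meant for A with quotient field K, as in the case of D and of its
   localizations, all of which have the same quotient field. *)
Definition overrings (K : fieldType) (A : set K) : set (set K) :=
  [set B | subring B /\ A `<=` B].

Definition ql_overrings (K : fieldType) (A : set K) : set (set K) :=
  [set B | overrings A B /\ quasi_local B].

(* Takes the value 0 on infinite sets. *)
Definition nb_elements (T : choiceType) (S : set T) : nat := #|` fset_set S|%fset.

(* Main.v *)
Require Import Defs.
From mathcomp Require Import all_boot all_order all_algebra finmap.
From mathcomp Require Import boolp classical_sets functions cardinality fsbigop.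
From mathcomp Require Import ring.

Set Implicit Arguments.
Unset Strict Implicit.
Unset Printing Implicit Defensive.

Import GRing.Theory.
Local Open Scope classical_set_scope.
Local Open Scope ring_scope.

(** The count rests on the fact that every overring of a quasi-local MPD domain
    A with quotient field K is quasi-local ([overring_local]).

    In a quasi-local domain the nonzero invertible ideals are the principal
    ones, so the MPD condition says that every nonzero ideal of A is either
    principal or of the form zQ with z in A, where Q is one fixed non-principal
    ideal.  Let B be an overring of A and b in B; one has to show that b or
    1 - b is a unit of B.  This is clear if b or 1/b lies in A.  Otherwise
    I = A + Ab and I^2 are not principal, so both are multiples of Q, and
    I^2 = wI for some w.  Then E = w^-1 I satisfies E^2 = E and, being finitely
    generated, it contains 1 by Nakayama's lemma: E is a ring, I = wE, and
    E is contained in I, hence in B.  Moreover Q is a multiple of E, and for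
    nonzero y in E the ideal yQ equals zQ with z in A; so each nonzero element
    of E is a unit of E times an element of A.  As the maximal ideal m of A
    satisfies mE != E, this makes E quasi-local.  Finally wE = A + Ab forces b
    or 1/b into E, and b or 1 - b is a unit of B since E is contained in B.

    Now let D be GMPD.  A quasi-local overring B of D meets its own maximal
    ideal in a prime P of D.  If P = 0 then B = K; otherwise P lies in a unique
    maximal ideal M of D, and M is the only maximal ideal with D_M contained
    in B.  Hence the quasi-local overrings other than K are the disjoint union
    over M of the overrings of D_M other than K ([ql_overringsE]).  Each D_M
    has K among its overrings, whence the term -|Max(D)|, and K itself
    contributes the final 1. *)

(** * Subrings and submodules of a field *)

Lemma subringP (K : fieldType) (A : set K) :
  subring A <-> [/\ A 1, forall x y, A x -> A y -> A (x - y)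
                  & forall x y, A x -> A y -> A (x * y)].
Proof.
split=> -[A1 AB AM]; split=> [|x y|x y].
- exact: set_mem.
- by move=> /mem_set Ax /mem_set Ay; apply/set_mem/AB.
- by move=> /mem_set Ax /mem_set Ay; apply/set_mem/AM.
- exact: mem_set.
- by move=> /set_mem Ax /set_mem Ay; apply/mem_set/AB.
- by move=> /set_mem Ax /set_mem Ay; apply/mem_set/AM.
Qed.

Lemma submoduleP (K : fieldType) (A I : set K) :
  submodule A I <-> [/\ I 0, forall x y, I x -> I y -> I (x - y)
                     & forall a x, A a -> I x -> I (a * x)].
Proof.
split=> [[[I0 IB] IZ]|[I0 IB IZ]]; split=> //.
- exact: set_mem.
- by move=> x y /mem_set Ix /mem_set Iy; apply/set_mem/IB.
- split=> [|x y]; first exact: mem_set.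
  by move=> /set_mem Ix /set_mem Iy; apply/mem_set/IB.
Qed.

Lemma submoduleD (K : fieldType) (A I : set K) (x y : K) :
  submodule A I -> I x -> I y -> I (x + y).
Proof.
move=> /submoduleP[I0 IB _] Ix Iy; have := IB _ _ Ix (IB _ _ I0 Iy).
by rewrite sub0r opprK.
Qed.

Lemma submodule_sum (K : fieldType) (A I : set K) (n : nat) (f : 'I_n -> K) :
  submodule A I -> (forall i, I (f i)) -> I (\sum_(i < n) f i).
Proof.
move=> sI If; apply: (big_ind I) => [|x y|i _].
- by case/submoduleP: sI.
- exact: submoduleD sI.
- exact: If.
Qed.

Lemma subring_submodule (K : fieldType) (A : set K) : subring A -> submodule A A.
Proof.
move=> /subringP[A1 AB AM]; apply/submoduleP; split=> //.
by rewrite -(subrr 1); apply: AB.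
Qed.

Lemma subring0 (K : fieldType) (A : set K) : subring A -> A 0.
Proof. by move=> /subring_submodule/submoduleP[]. Qed.

Lemma subring1 (K : fieldType) (A : set K) : subring A -> A 1.
Proof. by case/subringP. Qed.

Lemma subringB (K : fieldType) (A : set K) (x y : K) :
  subring A -> A x -> A y -> A (x - y).
Proof. by case/subringP => _ AB _; exact: AB. Qed.

Lemma subringD (K : fieldType) (A : set K) (x y : K) :
  subring A -> A x -> A y -> A (x + y).
Proof. by move=> /subring_submodule; exact: submoduleD. Qed.

Lemma subringM (K : fieldType) (A : set K) (x y : K) :
  subring A -> A x -> A y -> A (x * y).
Proof. by case/subringP => _ _ AM; exact: AM. Qed.

(** * Units and quasi-local rings *)

(** The condition x != 0 is needed because 0^-1 = 0 belongs to A. *)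
Definition unit_in (K : fieldType) (A : set K) (x : K) : Prop :=
  [/\ x != 0, A x & A x^-1].

(** An element-wise form of quasi-locality, for which no maximal ideal has to be
    produced; [quasi_localP] compares the two. *)
Definition local (K : fieldType) (A : set K) : Prop :=
  forall x, A x -> unit_in A x \/ unit_in A (1 - x).

Definition scale (K : fieldType) (a : K) (I : set K) : set K :=
  [set a * x | x in I].

Lemma unit_in1 (K : fieldType) (A : set K) : subring A -> unit_in A 1.
Proof. by move=> /subring1 A1; split; rewrite ?oner_neq0 ?invr1. Qed.

Lemma unit_in_sub (K : fieldType) (A B : set K) (x : K) :
  A `<=` B -> unit_in A x -> unit_in B x.
Proof. by move=> AB [x0 Ax Ax']; split=> //; apply: AB. Qed.

Lemma unit_inM (K : fieldType) (A : set K) (x y : K) :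
  subring A -> unit_in A x -> unit_in A y -> unit_in A (x * y).
Proof.
move=> rA [x0 Ax Ax'] [y0 Ay Ay']; split; rewrite ?mulf_neq0 ?invfM //;
exact: subringM.
Qed.

Lemma unit_in_factor (K : fieldType) (A : set K) (x y : K) :
  subring A -> A x -> A y -> unit_in A (x * y) -> unit_in A x.
Proof.
move=> rA Ax Ay [xy0 _ Axy']; move: (xy0); rewrite mulf_eq0 negb_or => /andP[x0 y0].
split=> //; have -> : x^-1 = (x * y)^-1 * y by field; rewrite x0 y0.
exact: subringM.
Qed.

Lemma local_unitD (K : fieldType) (A : set K) (x y : K) :
  subring A -> local A -> A x -> A y -> unit_in A (x + y) ->
  unit_in A x \/ unit_in A y.
Proof.
move=> rA lA Ax Ay uxy; have [xy0 _ Axy'] := uxy.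
have split_unit z : unit_in A (z / (x + y)) -> unit_in A z.
  by move=> uz; rewrite -(divfK xy0 z); exact: unit_inM.
have [/split_unit|] := lA _ (subringM rA Ax Axy'); first by left.
have -> : 1 - x / (x + y) = y / (x + y) by field.
by move/split_unit; right.
Qed.

Lemma local_unit_sum (K : fieldType) (A : set K) (n : nat) (f : 'I_n -> K) :
  subring A -> local A -> (forall i, A (f i)) -> unit_in A (\sum_(i < n) f i) ->
  exists i, unit_in A (f i).
Proof.
move=> rA lA; elim: n f => [|n IHn] f Af; first by rewrite big_ord0 => -[/eqP].
rewrite big_ord_recl => /(local_unitD rA lA)[] //.
- exact: submodule_sum (subring_submodule rA) _.
- by exists ord0.
- by case/IHn => // i ui; exists (lift ord0 i).
Qed.

(** * Quasi-local MPD domains *)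

Lemma mem_scale (K : fieldType) (a x : K) (I : set K) :
  a != 0 -> scale a I x <-> I (x / a).
Proof.
move=> a0; split; first by move=> [y Iy <-]; rewrite mulrC mulKf.
by move=> Ix; exists (x / a) => //; rewrite mulrC divfK.
Qed.

Lemma scaleA (K : fieldType) (a b : K) (I : set K) :
  scale a (scale b I) = scale (a * b) I.
Proof.
apply/seteqP; split=> [_ [_ [x Ix <-] <-]|_ [x Ix <-]].
  by exists x => //; rewrite mulrA.
by exists (b * x); [exists x|rewrite mulrA].
Qed.

Lemma scale1 (K : fieldType) (I : set K) : scale 1 I = I.
Proof.
apply/seteqP; split=> [_ [x Ix <-]|x Ix]; first by rewrite mul1r.
by exists x; rewrite ?mul1r.
Qed.

Lemma scale_eq (K : fieldType) (a : K) (I J : set K) :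
  a != 0 -> scale a I = J -> I = scale a^-1 J.
Proof. by move=> a0 <-; rewrite scaleA mulVf // scale1. Qed.

Lemma scale_submodule (K : fieldType) (A I : set K) (a : K) :
  submodule A I -> submodule A (scale a I).
Proof.
move=> /submoduleP[I0 IB IZ]; apply/submoduleP; split.
- by exists 0; rewrite ?mulr0.
- by move=> _ _ [x Ix <-] [y Iy <-]; exists (x - y); [exact: IB|rewrite mulrBr].
- by move=> b _ Ab [x Ix <-]; exists (b * x); [exact: IZ|rewrite mulrCA].
Qed.

(** If 1 = sum_i a_i b_i with a_i in I and b_i in the inverse of I, then some
    a_i b_i is a unit, and this a_i generates I. *)
Lemma invertible_principal (K : fieldType) (A I : set K) :
  subring A -> local A -> submodule A I -> invertible_ideal A I ->
  exists a, [/\ I a, a != 0 & I = scale a A].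
Proof.
move=> rA lA sI [J [[sJ _] IJA]].
have IJ x y : I x -> J y -> A (x * y).
  move=> Ix Jy; rewrite -IJA; exists 1%N, (fun=> x), (fun=> y); split=> //.
  by rewrite big_ord1.
have : A 1 by exact: subring1.
rewrite -[in X in X -> _]IJA => -[n [a [b [ab sum1]]]].
have Aab i : A (a i * b i) by case: (ab i) => ? ?; exact: IJ.
have [|i uab] := local_unit_sum rA lA Aab; first by rewrite -sum1; exact: unit_in1.
have [Ia Jb] := ab i.
have [ab0 _ Aab'] := uab.
have a0 : a i != 0 by apply: contra_neq ab0 => ->; rewrite mul0r.
have b0 : b i != 0 by apply: contra_neq ab0 => ->; rewrite mulr0.
exists (a i); split=> //; apply/seteqP; split=> [x Ix|_ [x Ax <-]].
  apply/mem_scale => //.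
  have -> : x / a i = (x * b i) * (a i * b i)^-1 by field; rewrite a0 b0.
  by apply: subringM => //; exact: IJ.
by rewrite mulrC; case/submoduleP: sI => _ _; exact.
Qed.

Lemma principal_invertible (K : fieldType) (A : set K) (a : K) :
  subring A -> A a -> a != 0 -> invertible_ideal A (scale a A).
Proof.
move=> rA Aa a0; exists (scale a^-1 A); split.
  split; first exact: scale_submodule (subring_submodule rA).
  by exists a; split=> // _ [x Ax <-]; rewrite mulVKf.
apply/seteqP; split=> [_ [n [x [y [xy ->]]]]|x Ax].
  apply: submodule_sum (subring_submodule rA) _ => i.
  have [[u Au <-] [v Av <-]] := xy i.
  by rewrite mulrACA divff // mul1r; exact: subringM.
exists 1%N, (fun=> a * x), (fun=> a^-1); split; last first.
  by rewrite big_ord1; field.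
by move=> _; split; [exists x|exists 1; rewrite ?mulr1 //; exact: subring1].
Qed.

(** The MPD condition in a quasi-local ring, with invertible ideals replaced by
    principal ones.  The multiplier z is in A, and not merely in K, because the
    invertible factor of a non-invertible ideal is an integral ideal. *)
Definition pinched (K : fieldType) (A Q : set K) : Prop :=
  [/\ ideal A Q, forall a, a != 0 -> Q <> scale a A
    & forall I, ideal A I -> I != [set 0] ->
        (exists2 a, a != 0 & I = scale a A) \/ (exists2 z, A z & I = scale z Q)].

Lemma mod_prod_scale (K : fieldType) (A Q : set K) (z : K) :
  subring A -> submodule A Q -> mod_prod (scale z A) Q = scale z Q.
Proof.
move=> rA sQ; apply/seteqP; split=> [_ [n [x [y [xy ->]]]]|_ [x Qx <-]].
  apply: (submodule_sum (scale_submodule z sQ)) => i.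
  have [[u Au <-] Qy] := xy i; rewrite -mulrA; exists (u * y i) => //.
  by case/submoduleP: sQ => _ _; exact.
exists 1%N, (fun=> z), (fun=> x); split; last by rewrite big_ord1.
by move=> _; split=> //; exists 1; rewrite ?mulr1 //; exact: subring1.
Qed.

Lemma MPD_pinched (K : fieldType) (A : set K) :
  subring A -> local A -> MPD A -> exists Q, pinched A Q.
Proof.
move=> rA lA [Q [[[idQ ninvQ] _] _ QP]]; have [sQ QA] := idQ.
exists Q; split=> //.
  move=> a a0 Qa; apply: ninvQ; rewrite Qa; apply: principal_invertible => //.
  by apply: QA; rewrite Qa; exists 1; rewrite ?mulr1 //; exact: subring1.
move=> I idI I0; have [sI IA] := idI.
have [invI|ninvI] := pselect (invertible_ideal A I).
  by left; have [a [_ a0 ->]] := invertible_principal rA lA sI invI; exists a.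
right; have [J [[sJ JA] invJ ->]] := QP I idI I0 ninvI.
have [z [Jz _ ->]] := invertible_principal rA lA sJ invJ.
by exists z; [exact: JA|exact: mod_prod_scale].
Qed.

(** The determinant trick for two generators, the form in which Nakayama's
    lemma is used below. *)
Lemma cramer2 (K : fieldType) (a b c d f g : K) :
  f = a * f + b * g -> g = c * f + d * g -> (f != 0) || (g != 0) ->
  (1 - a) * (1 - d) = b * c.
Proof.
move=> Ef Eg fg.
have Hf : ((1 - a) * (1 - d) - b * c) * f = 0.
  have -> : ((1 - a) * (1 - d) - b * c) * f
    = (1 - d) * (f - (a * f + b * g)) + b * (g - (c * f + d * g)) by ring.
  by rewrite -Ef -Eg !subrr !mulr0 addr0.
have Hg : ((1 - a) * (1 - d) - b * c) * g = 0.
  have -> : ((1 - a) * (1 - d) - b * c) * g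
    = (1 - a) * (g - (c * f + d * g)) + c * (f - (a * f + b * g)) by ring.
  by rewrite -Ef -Eg !subrr !mulr0 addr0.
apply/eqP; rewrite -subr_eq0; case/orP: fg => n0.
  by move/eqP: Hf; rewrite mulf_eq0 (negbTE n0) orbF.
by move/eqP: Hg; rewrite mulf_eq0 (negbTE n0) orbF.
Qed.

Lemma pinched_fractional (K : fieldType) (A Q I : set K) (d x : K) :
  pinched A Q -> submodule A I -> d != 0 -> scale d I `<=` A ->
  I x -> x != 0 ->
  (exists2 a, a != 0 & I = scale a A) \/ (exists2 w, w != 0 & I = scale w Q).
Proof.
move=> [[sQ _] _ QP] sI d0 dIA Ix x0.
have dI0 : scale d I != [set 0].
  apply/eqP => dI0; have : scale d I (d * x) by exists x.
  by rewrite dI0 => /= /eqP; rewrite mulf_eq0 (negbTE d0) (negbTE x0).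
have dV0 : d^-1 != 0 by rewrite invr_eq0.
have [|[a a0 /(scale_eq d0)]|[z Az dIz]] := QP (scale d I) _ dI0.
- by split=> //; exact: scale_submodule.
- by rewrite scaleA => ->; left; exists (d^-1 * a); rewrite ?mulf_neq0.
right; exists (d^-1 * z); last by rewrite -scaleA -dIz scaleA mulVf // scale1.
rewrite mulf_neq0 //; apply: contraNneq dI0 => z0; rewrite dIz z0.
apply/eqP/seteqP; split=> [_ [y _ <-]|_ ->]; first by rewrite mul0r.
by exists 0; rewrite ?mul0r //; case/submoduleP: sQ.
Qed.

(** * The fractional ideal A + Ab and its multiplier ring *)

Definition span2 (K : fieldType) (A : set K) (b : K) : set K :=
  [set x | exists r s, [/\ A r, A s & x = r + s * b]].

(** The square of [span2 A b]. *)
Definition span3 (K : fieldType) (A : set K) (b : K) : set K :=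
  [set x | exists r s t, [/\ A r, A s, A t & x = r + s * b + t * b ^+ 2]].

Lemma span2_submodule (K : fieldType) (A : set K) (b : K) :
  subring A -> submodule A (span2 A b).
Proof.
move=> rA; apply/submoduleP; split.
- by exists 0, 0; split; [exact: subring0|exact: subring0|ring].
- move=> _ _ [r [s [Ar As ->]]] [r' [s' [Ar' As' ->]]].
  by exists (r - r'), (s - s'); split; [exact: subringB|exact: subringB|ring].
- move=> a _ Aa [r [s [Ar As ->]]].
  by exists (a * r), (a * s); split; [exact: subringM|exact: subringM|ring].
Qed.

Lemma span3_submodule (K : fieldType) (A : set K) (b : K) :
  subring A -> submodule A (span3 A b).
Proof.
move=> rA; have A0 := subring0 rA; apply/submoduleP; split.
- by exists 0, 0, 0; split=> //; ring.
- move=> _ _ [r [s [t [Ar As At ->]]]] [r' [s' [t' [Ar' As' At' ->]]]].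
  exists (r - r'), (s - s'), (t - t').
  by split; last ring; apply: subringB.
- move=> a _ Aa [r [s [t [Ar As At ->]]]].
  by exists (a * r), (a * s), (a * t); split; last ring; apply: subringM.
Qed.

Lemma span2_1 (K : fieldType) (A : set K) (b : K) : subring A -> span2 A b 1.
Proof.
by move=> rA; exists 1, 0; split; [exact: subring1|exact: subring0|ring].
Qed.

Lemma span2_gen (K : fieldType) (A : set K) (b : K) : subring A -> span2 A b b.
Proof.
by move=> rA; exists 0, 1; split; [exact: subring0|exact: subring1|ring].
Qed.

Lemma span2M (K : fieldType) (A : set K) (b x y : K) :
  subring A -> span2 A b x -> span2 A b y -> span3 A b (x * y).
Proof.
move=> rA [r [s [Ar As ->]]] [r' [s' [Ar' As' ->]]].
exists (r * r'), (r * s' + s * r'), (s * s'); split; last by ring.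
- exact: subringM.
- by apply: subringD => //; apply: subringM.
- exact: subringM.
Qed.

(** For the case that a generates an ideal containing 1 and b: if a is
    associated to 1 then b is in aA = A, and if to b then 1 is in aA = bA. *)
Lemma unit_ratio (K : fieldType) (A : set K) (a b : K) :
  subring A -> a != 0 -> A (a^-1) -> A (b / a) ->
  unit_in A a^-1 \/ unit_in A (b / a) -> A b \/ A b^-1.
Proof.
move=> rA a0 Aa' Aba [[_ _]|[ba0 _ Aba']].
  by rewrite invrK => Aa; left; rewrite -(divfK a0 b); exact: subringM.
have b0 : b != 0 by apply: contra_neq ba0 => ->; rewrite mul0r.
right; have -> : b^-1 = a^-1 * (b / a)^-1 by field; rewrite a0 b0.
exact: subringM.
Qed.

Lemma span2_principal (K : fieldType) (A : set K) (a b : K) :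
  subring A -> local A -> a != 0 -> span2 A b = scale a A -> A b \/ A b^-1.
Proof.
move=> rA lA a0 Ia.
have Aa : A a^-1.
  by rewrite -[a^-1]mul1r; apply/(mem_scale _ _ a0); rewrite -Ia; exact: span2_1.
have Ab : A (b / a) by apply/(mem_scale _ _ a0); rewrite -Ia; exact: span2_gen.
have : span2 A b a by rewrite Ia; exists 1; rewrite ?mulr1 //; exact: subring1.
move=> [r [s [Ar As ars]]].
have [Aar Abs] := (subringM rA Aa Ar, subringM rA Ab As).
have : unit_in A (a^-1 * r + b / a * s).
  have -> : a^-1 * r + b / a * s = (r + s * b) / a by field.
  by rewrite -ars divff //; exact: unit_in1.
by move=> /(local_unitD rA lA Aar Abs)[] u; apply: (unit_ratio rA a0) => //;
  [left|right]; move: u; exact: unit_in_factor.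
Qed.

(** If (A + Ab)^2 = aA, then a is associated to 1, b or b^2; the first two cases
    are as before, and in the last one 1/b = b / b^2 is in A. *)
Lemma span3_principal (K : fieldType) (A : set K) (a b : K) :
  subring A -> local A -> a != 0 -> span3 A b = scale a A -> A b \/ A b^-1.
Proof.
move=> rA lA a0 Ia; have [A0 A1] := (subring0 rA, subring1 rA).
have Aa : A a^-1.
  rewrite -[a^-1]mul1r; apply/(mem_scale _ _ a0); rewrite -Ia.
  by exists 1, 0, 0; split=> //; ring.
have Ab : A (b / a).
  by apply/(mem_scale _ _ a0); rewrite -Ia; exists 0, 1, 0; split=> //; ring.
have Abb : A (b ^+ 2 / a).
  by apply/(mem_scale _ _ a0); rewrite -Ia; exists 0, 0, 1; split=> //; ring.
have : span3 A b a by rewrite Ia; exists 1; rewrite ?mulr1.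
move=> [r [s [t [Ar As At ars]]]].
have [Aar Abs] := (subringM rA Aa Ar, subringM rA Ab As).
have Abt := subringM rA Abb At.
have : unit_in A (a^-1 * r + b / a * s + b ^+ 2 / a * t).
  have -> : a^-1 * r + b / a * s + b ^+ 2 / a * t
            = (r + s * b + t * b ^+ 2) / a by field.
  by rewrite -ars divff //; exact: unit_in1.
move=> /(local_unitD rA lA (subringD rA Aar Abs) Abt)[|u].
  by move=> /(local_unitD rA lA Aar Abs)[] u; apply: (unit_ratio rA a0) => //;
    [left|right]; move: u; exact: unit_in_factor.
have [bb0 _ Abb'] : unit_in A (b ^+ 2 / a) by move: u; exact: unit_in_factor.
have b0 : b != 0 by apply: contra_neq bb0 => ->; rewrite expr0n mul0r.
right; have -> : b^-1 = b / a * (b ^+ 2 / a)^-1 by field; rewrite a0 b0.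
exact: subringM.
Qed.

(** Neither A + Ab nor its square is principal, so each is a multiple of Q. *)
Lemma span_pinched (K : fieldType) (A Q : set K) (b : K) :
  subring A -> local A -> has_quotient_field A -> pinched A Q ->
  ~ A b -> ~ A b^-1 ->
  exists w q, [/\ w != 0, q != 0, span3 A b = scale w (span2 A b)
                & Q = scale q (span2 A b)].
Proof.
move=> rA lA fA pQ nAb nAb'; have [A0 A1] := (subring0 rA, subring1 rA).
have [c [d [Ac Ad d0 bE]]] := fA b.
have dbE : d * b = c by rewrite bE mulrC divfK.
have I2 : scale d (span2 A b) `<=` A.
  move=> _ [_ [r [s [Ar As ->]]] <-].
  have -> : d * (r + s * b) = d * r + s * (d * b) by ring.
  by rewrite dbE; apply: subringD => //; exact: subringM.
have I3 : scale (d ^+ 2) (span3 A b) `<=` A.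
  move=> _ [_ [r [s [t [Ar As At ->]]]] <-].
  have -> : d ^+ 2 * (r + s * b + t * b ^+ 2)
    = d * d * r + s * d * (d * b) + t * (d * b) * (d * b) by ring.
  rewrite dbE; apply: subringD => //; last by do 2!apply: subringM => //.
  by apply: subringD => //; apply: subringM => //; exact: subringM.
have [|[a a0 /(span2_principal rA lA a0)[]//]|[u u0 I2Q]] :=
  pinched_fractional pQ (span2_submodule b rA) d0 I2 _ (oner_neq0 _).
  exact: span2_1.
have [||[a a0 /(span3_principal rA lA a0)[]//]|[v v0 I3Q]] :=
  pinched_fractional pQ (span3_submodule b rA) _ I3 _ (oner_neq0 _).
- by rewrite expf_neq0.
- by exists 1, 0, 0; split=> //; ring.
have QE := scale_eq u0 (esym I2Q).
exists (v / u), u^-1; rewrite ?mulf_neq0 ?invr_eq0 //; split=> //.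
by rewrite I3Q {1}QE scaleA.
Qed.

(** The fractional ideal w^-1 (A + Ab).  When (A + Ab)^2 = w (A + Ab) it is
    its own square, and turns out to be the multiplier ring of A + Ab. *)
Definition ratio_ring (K : fieldType) (A : set K) (b w : K) : set K :=
  [set x | span2 A b (x * w)].

Lemma ratio_ring_span2M (K : fieldType) (A : set K) (b w x y : K) :
  subring A -> w != 0 -> span3 A b = scale w (span2 A b) ->
  ratio_ring A b w x -> span2 A b y -> span2 A b (x * y).
Proof.
move=> rA w0 I3 Ex Iy; have := span2M rA Ex Iy.
by rewrite I3 mulrAC => /(mem_scale _ _ w0); rewrite mulfK.
Qed.

Lemma ratio_ring_div (K : fieldType) (A : set K) (b w x : K) :
  w != 0 -> span2 A b x -> ratio_ring A b w (x / w).
Proof. by move=> w0 Ix; rewrite /ratio_ring/= divfK. Qed.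

(** Only the membership of 1 is not formal: it is Nakayama's lemma for the
    idempotent ideal E = w^-1 (A + Ab), whose two generators 1/w and b/w are
    combinations of themselves with coefficients in E because E = E^2. *)
Lemma ratio_ring_subring (K : fieldType) (A : set K) (b w : K) :
  subring A -> w != 0 -> span3 A b = scale w (span2 A b) ->
  subring (ratio_ring A b w).
Proof.
move=> rA w0 I3; set E := ratio_ring A b w.
have sI := span2_submodule b rA.
have [_ IB IZ] := proj1 (submoduleP _ _) sI.
have EM x y : E x -> E y -> E (x * y).
  by move=> Ex Ey; rewrite /E/ratio_ring/= -mulrA; exact: ratio_ring_span2M I3 _ _.
have EB x y : E x -> E y -> E (x - y).
  by rewrite /E/ratio_ring/= mulrBl; exact: IB.
have ED x y : E x -> E y -> E (x + y).
  by rewrite /E/ratio_ring/= mulrDl; exact: (submoduleD sI).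
have Iw x : span2 A b x -> span3 A b (x * w).
  by move=> Ix; rewrite I3; exists x => //; rewrite mulrC.
apply/subringP; split=> //.
have [r [s [t [Ar As At wE]]]] := Iw _ (span2_1 b rA).
have [r' [s' [t' [Ar' As' At' bwE]]]] := Iw _ (span2_gen b rA).
have C : (1 - (r + s * b) / w) * (1 - t' * b / w)
         = t * b / w * ((r' + s' * b) / w).
  apply: (@cramer2 _ _ _ _ _ w^-1 (b / w)); last by rewrite invr_eq0 w0.
    apply: (mulIf w0).
    by rewrite mulVf // -[LHS](mulfV w0) -[X in X / w]mul1r wE; field.
  by apply: (mulIf w0); rewrite divfK // -[LHS](mulfK w0) bwE; field.
have -> : 1 = (r + s * b) / w + t' * b / w - (r + s * b) / w * (t' * b / w)
             + t * b / w * ((r' + s' * b) / w) by rewrite -C; ring.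
have gE x y : A x -> A y -> E ((x + y * b) / w).
  by move=> Ax Ay; apply: ratio_ring_div => //; exists x, y.
have hE x : A x -> E (x * b / w).
  by move=> Ax; apply: ratio_ring_div => //; apply: IZ => //; exact: span2_gen.
apply: (ED); last by apply: EM; [exact: hE|exact: gE].
apply: EB; last by apply: EM; [exact: gE|exact: hE].
by apply: ED; [exact: gE|exact: hE].
Qed.

Lemma sub_ratio_ring (K : fieldType) (A : set K) (b w : K) :
  subring A -> w != 0 -> span3 A b = scale w (span2 A b) ->
  A `<=` ratio_ring A b w.
Proof.
move=> rA w0 I3 a Aa; rewrite /ratio_ring/= -[w]mul1r.
have [_ _ IZ] := proj1 (submoduleP _ _) (span2_submodule b rA); apply: IZ => //.
exact: subring1 (ratio_ring_subring rA w0 I3).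
Qed.

Lemma ratio_ring_sub_span2 (K : fieldType) (A : set K) (b w : K) :
  subring A -> w != 0 -> span3 A b = scale w (span2 A b) ->
  ratio_ring A b w `<=` span2 A b.
Proof.
move=> rA w0 I3 x Ex; rewrite -[x]mulr1.
exact: ratio_ring_span2M I3 Ex (span2_1 b rA).
Qed.

(** Nakayama's lemma again: the maximal ideal m of A satisfies mE != E, since
    otherwise m(A + Ab) would contain the generators 1 and b, and the
    determinant of the resulting relations is a unit of A. *)
Lemma ratio_ring_nonunit_comb (K : fieldType) (A : set K) (b w z z' e e' : K) :
  subring A -> local A -> w != 0 -> span3 A b = scale w (span2 A b) ->
  A z -> ~ unit_in A z -> A z' -> ~ unit_in A z' ->
  ratio_ring A b w e -> ratio_ring A b w e' -> z * e + z' * e' <> 1.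
Proof.
move=> rA lA w0 I3 Az nz Az' nz' Ee Ee' sum1.
have EI := ratio_ring_sub_span2 rA w0 I3.
have Ieb x : ratio_ring A b w x -> span2 A b (x * b).
  by move=> Ex; exact: ratio_ring_span2M I3 Ex (span2_gen b rA).
have [r [s [Ar As eE]]] := EI _ Ee.
have [r' [s' [Ar' As' e'E]]] := EI _ Ee'.
have [t [u [At Au ebE]]] := Ieb _ Ee.
have [t' [u' [At' Au' eb'E]]] := Ieb _ Ee'.
have C : (1 - (z * r + z' * r')) * (1 - (z * u + z' * u'))
         = (z * s + z' * s') * (z * t + z' * t').
  apply: (@cramer2 _ _ _ _ _ 1 b); last by rewrite oner_neq0.
    by rewrite -[LHS]sum1 eE e'E; ring.
  transitivity (z * (e * b) + z' * (e' * b)).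
    by rewrite -[LHS]mul1r -sum1; ring.
  by rewrite ebE eb'E; ring.
have nonunit x y : A x -> A y -> ~ unit_in A (z * x + z' * y).
  move=> Ax Ay /(local_unitD rA lA (subringM rA Az Ax) (subringM rA Az' Ay)).
  by case=> /(unit_in_factor rA) uz; [apply: nz|apply: nz']; apply: uz.
have Alin x y : A x -> A y -> A (z * x + z' * y).
  by move=> Ax Ay; apply: subringD => //; exact: subringM.
have unit1B x y : A x -> A y -> unit_in A (1 - (z * x + z' * y)).
  by move=> Ax Ay; case: (lA _ (Alin _ _ Ax Ay)) => // /(nonunit _ _ Ax Ay).
have := unit_inM rA (unit1B _ _ Ar Ar') (unit1B _ _ Au Au').
rewrite C => /(unit_in_factor rA (Alin _ _ As As') (Alin _ _ At At')).
exact: nonunit.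
Qed.

(** Here it matters that an ideal is JQ with J inside A: yQ is an ideal of A
    that is not principal, so yQ = zQ with z in A, and Q is a multiple of E. *)
Lemma ratio_ring_assoc (K : fieldType) (A Q : set K) (b w q y : K) :
  subring A -> pinched A Q -> w != 0 -> span3 A b = scale w (span2 A b) ->
  q != 0 -> Q = scale q (span2 A b) -> ratio_ring A b w y -> y != 0 ->
  exists2 z, A z & exists2 e, unit_in (ratio_ring A b w) e & y = z * e.
Proof.
move=> rA [[sQ QA] npQ QP] w0 I3 q0 QI Ey y0.
have yQ : scale y Q `<=` Q.
  rewrite QI => _ [_ [i Ii <-] <-]; exists (y * i); last by ring.
  exact: ratio_ring_span2M I3 Ey Ii.
have Qq : Q q by rewrite QI; exists 1; rewrite ?mulr1 //; exact: span2_1.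
have yQ0 : scale y Q != [set 0].
  apply/eqP => yQ0; have : scale y Q (y * q) by exists q.
  by rewrite yQ0 => /= /eqP; rewrite mulf_eq0 (negbTE y0) (negbTE q0).
have [|[a a0 /(scale_eq y0)]|[z Az yzQ]] := QP (scale y Q) _ yQ0.
- by split; [exact: scale_submodule|move=> x /yQ /QA].
- by rewrite scaleA => /npQ []; rewrite mulf_neq0 ?invr_eq0.
exists z => //.
have z0 : z != 0.
  apply: contraNneq yQ0 => z0; rewrite yzQ z0; apply/eqP/seteqP.
  split=> [_ [x _ <-]|_ ->]; first by rewrite mul0r.
  by exists q; rewrite ?mul0r.
have yzI : scale y (span2 A b) = scale z (span2 A b).
  by rewrite (scale_eq q0 (esym QI)) !scaleA ![_ * q^-1]mulrC -!scaleA yzQ.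
have Iw : span2 A b w.
  by rewrite -[w]mul1r; exact: subring1 (ratio_ring_subring rA w0 I3).
exists (y / z); last by rewrite mulrC divfK.
split; first by rewrite mulf_neq0 // invr_eq0.
  have : scale z (span2 A b) (y * w) by rewrite -yzI; exists w.
  by move/(mem_scale _ _ z0); rewrite /ratio_ring/= mulrAC.
have : scale y (span2 A b) (z * w) by rewrite yzI; exists w.
by move/(mem_scale _ _ y0); rewrite /ratio_ring/= invf_div mulrAC.
Qed.

Lemma ratio_ring_local (K : fieldType) (A Q : set K) (b w q : K) :
  subring A -> local A -> pinched A Q ->
  w != 0 -> span3 A b = scale w (span2 A b) ->
  q != 0 -> Q = scale q (span2 A b) -> local (ratio_ring A b w).
Proof.
move=> rA lA pQ w0 I3 q0 QI y Ey.
have rE := ratio_ring_subring rA w0 I3; have AE := sub_ratio_ring rA w0 I3.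
have [->|y0] := eqVneq y 0; first by right; rewrite subr0; exact: unit_in1.
have [->|] := eqVneq y 1; first by left; exact: unit_in1.
rewrite eq_sym -subr_eq0 => y1.
have E1y := subringB rE (subring1 rE) Ey.
have [z Az [e ue yE]] := ratio_ring_assoc rA pQ w0 I3 q0 QI Ey y0.
have [z' Az' [e' ue' y'E]] := ratio_ring_assoc rA pQ w0 I3 q0 QI E1y y1.
have [uz|nz] := pselect (unit_in A z).
  by left; rewrite yE; apply: unit_inM => //; exact: unit_in_sub uz.
have [uz'|nz'] := pselect (unit_in A z').
  by right; rewrite y'E; apply: unit_inM => //; exact: unit_in_sub uz'.
have [[_ Ee _] [_ Ee' _]] := (ue, ue').
have := ratio_ring_nonunit_comb rA lA w0 I3 Az nz Az' nz' Ee Ee'.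
by rewrite -yE -y'E; case; ring.
Qed.

(** Since A + Ab = wE contains 1 and b, writing w = r + s b gives
    1 = r (1/w) + s (b/w) in the local ring E, so 1/w or b/w is a unit of E. *)
Lemma span2_local_subring (K : fieldType) (A Q : set K) (b : K) :
  subring A -> local A -> has_quotient_field A -> pinched A Q ->
  ~ A b -> ~ A b^-1 ->
  exists E, [/\ subring E, local E, E `<=` span2 A b & E b \/ E b^-1].
Proof.
move=> rA lA fA pQ nAb nAb'.
have [w [q [w0 q0 I3 QI]]] := span_pinched rA lA fA pQ nAb nAb'.
have rE := ratio_ring_subring rA w0 I3; have AE := sub_ratio_ring rA w0 I3.
have lE := ratio_ring_local rA lA pQ w0 I3 q0 QI.
exists (ratio_ring A b w); split=> //; first exact: ratio_ring_sub_span2.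
set E := ratio_ring A b w in rE AE lE *.
have [r [s [Ar As wE]]] : span2 A b w by rewrite -[w]mul1r; exact: subring1 rE.
have Ew : E w^-1.
  by rewrite -[w^-1]mul1r; apply: ratio_ring_div => //; exact: span2_1.
have Ebw : E (b / w) by apply: ratio_ring_div => //; exact: span2_gen.
have EAr := subringM rE Ew (AE _ Ar).
have EAs := subringM rE Ebw (AE _ As).
have : unit_in E (w^-1 * r + b / w * s).
  have -> : w^-1 * r + b / w * s = (r + s * b) / w by field.
  by rewrite -wE divff //; exact: unit_in1.
move=> /(local_unitD rE lE EAr EAs)[] /(unit_in_factor rE) u;
  apply: (unit_ratio rE w0 Ew Ebw).
  by left; apply: u => //; exact: AE.
by right; apply: u => //; exact: AE.
Qed.

(** * Overrings of quasi-local MPD domains *)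

Lemma overring_local (K : fieldType) (A B : set K) :
  subring A -> local A -> has_quotient_field A -> MPD A ->
  subring B -> A `<=` B -> local B.
Proof.
move=> rA lA fA /(MPD_pinched rA lA)[Q pQ] rB AB b Bb.
have [->|b0] := eqVneq b 0; first by right; rewrite subr0; exact: unit_in1.
have [Ab|nAb] := pselect (A b).
  by case: (lA b Ab) => u; [left|right]; exact: unit_in_sub u.
have [Ab'|nAb'] := pselect (A b^-1); first by left; split=> //; exact: AB.
have [E [rE lE EI Ebb']] := span2_local_subring rA lA fA pQ nAb nAb'.
have EB : E `<=` B.
  move=> _ /EI[r [s [/AB Br /AB Bs ->]]].
  by apply: subringD => //; exact: subringM.
case: Ebb' => [Eb|/EB Bb']; last by left.
by case: (lE b Eb) => u; [left|right]; exact: unit_in_sub u.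
Qed.

(** * Maximal ideals *)

Definition nonunits (K : fieldType) (A : set K) : set K :=
  [set x | A x /\ ~ unit_in A x].

Lemma nonunits_ideal (K : fieldType) (A : set K) :
  subring A -> local A -> ideal A (nonunits A).
Proof.
move=> rA lA; split; last by move=> x [].
apply/submoduleP; split.
- by split; [exact: subring0|case=> /eqP].
- move=> x y [Ax nx] [Ay ny]; split; first exact: subringB.
  have ANy : A (- y) by rewrite -sub0r; apply: subringB => //; exact: subring0.
  have AN1 : A (- 1).
    by rewrite -sub0r; apply: subringB => //; [exact: subring0|exact: subring1].
  move=> /(local_unitD rA lA Ax ANy)[//|].
  by rewrite -mulrN1 => /(unit_in_factor rA Ay AN1).
- move=> a x Aa [Ax nx]; split; first exact: subringM.
  by rewrite mulrC => /(unit_in_factor rA Ax Aa).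
Qed.

Lemma ideal_eq (K : fieldType) (A I : set K) :
  subring A -> ideal A I -> I 1 -> I = A.
Proof.
move=> rA [/submoduleP[_ _ IZ] IA] I1; apply/seteqP; split=> // x Ax.
by rewrite -[x]mulr1; exact: IZ.
Qed.

Lemma proper_nonunits (K : fieldType) (A I : set K) :
  subring A -> ideal A I -> I != A -> I `<=` nonunits A.
Proof.
move=> rA idI /eqP IA x Ix; split; first exact: (proj2 idI).
case=> x0 _ Ax'; apply: IA; apply: ideal_eq => //; rewrite -(mulVf x0).
by case: idI => /submoduleP[_ _ IZ] _; exact: IZ.
Qed.

(** Zorn's lemma, applied to the proper ideals containing x.  The empty set is
    allowed as well, since it is the union of the empty chain. *)
Lemma nonunit_in_Max (K : fieldType) (A : set K) (x : K) :
  subring A -> nonunits A x -> exists M, Max A M /\ M x.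
Proof.
move=> rA [Ax nx].
pose P (I : set K) := I !=set0 -> [/\ ideal A I, I x & ~ I 1].
have [F FP Ftot|M [PM Mmax]] := @Zorn_bigcup K P.
  case=> y [X FX Xy].
  have PX Z : F Z -> Z !=set0 -> [/\ ideal A Z, Z x & ~ Z 1] by move=> /FP; apply.
  have [[/submoduleP[X0 _ _] _] Xx _] := PX X FX (ex_intro _ y Xy).
  split; last 2 first.
  - by exists X.
  - by case=> Z FZ Z1; case: (PX Z FZ (ex_intro _ 1 Z1)).
  split; last first.
    by move=> z [Z FZ Zz]; have [[_ ZA] _ _] := PX Z FZ (ex_intro _ z Zz); exact: ZA.
  apply/submoduleP; split.
  - by exists X.
  - move=> u v [U FU Uu] [V FV Vv].
    have [[/submoduleP[_ UB _] _] _ _] := PX U FU (ex_intro _ u Uu).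
    have [[/submoduleP[_ VB _] _] _ _] := PX V FV (ex_intro _ v Vv).
    by have [UV|VU] := Ftot U V FU FV; [exists V|exists U] => //;
      [apply: VB => //; exact: UV|apply: UB => //; exact: VU].
  - move=> a z Aa [Z FZ Zz]; exists Z => //.
    have [[/submoduleP[_ _ ZZ] _] _ _] := PX Z FZ (ex_intro _ z Zz).
    exact: ZZ.
have M0 : M !=set0.
  apply/set0P/eqP => M0; apply: (Mmax (scale x A)) => [|_].
    rewrite M0; split; first by move=> y [].
    by move=> /(_ x); apply; exists 1; rewrite ?mulr1 //; exact: subring1.
  split.
  - split; first exact: scale_submodule (subring_submodule rA).
    by move=> _ [y Ay <-]; exact: subringM.
  - by exists 1; rewrite ?mulr1 //; exact: subring1.
  - move=> [y Ay xy1]; apply: nx.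
    by apply: (unit_in_factor rA Ax Ay); rewrite xy1; exact: unit_in1.
have [idM Mx M1] := PM M0; exists M; split=> //; split.
  by split=> //; apply/eqP => MA; apply: M1; rewrite MA; exact: subring1.
move=> I [idI IA] MI; apply: contrapT => IM; apply: (Mmax I).
  by split=> // IM'; apply: IM; apply/seteqP.
move=> _; split=> //; first exact: MI.
by move=> /(ideal_eq rA idI) IAe; rewrite IAe eqxx in IA.
Qed.

(** From left to right, an element outside the only maximal ideal N is a unit,
    and x and 1 - x are not both in N. *)
Lemma quasi_localP (K : fieldType) (A : set K) :
  subring A -> quasi_local A <-> local A.
Proof.
move=> rA; split=> [[N [[[idN /eqP NA] _] Nuniq]] x Ax|lA].
  have unitN y : A y -> ~ N y -> unit_in A y.
    move=> Ay nNy; apply: contrapT => ny.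
    have [M [/Nuniq NM My]] : exists M, Max A M /\ M y by exact: nonunit_in_Max.
    by apply: nNy; rewrite NM.
  have [Nx|] := pselect (N x); last by left; exact: unitN.
  right; apply: unitN; first by apply: subringB => //; exact: subring1.
  move=> N1x; apply: NA; apply: ideal_eq => //.
  by rewrite -(subrK x 1); case: idN => sN _; exact: submoduleD sN _ _.
have idN := nonunits_ideal rA lA.
have NA : nonunits A != A.
  apply/eqP => NA; have : nonunits A 1 by rewrite NA; exact: subring1.
  by case=> _; apply; exact: unit_in1.
exists (nonunits A); split.
  split=> // I [idI IA] NI; apply/seteqP; split=> //.
  exact: proper_nonunits.
by move=> M [[idM MA] Mmax]; apply: Mmax => //; exact: proper_nonunits.
Qed.

Lemma Max_prime (K : fieldType) (A M : set K) (a b : K) :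
  subring A -> Max A M -> A a -> A b -> M (a * b) -> M a \/ M b.
Proof.
move=> rA [[[sM MA] Mproper] Mmax] Aa Ab Mab.
have [_ MB MZ] := proj1 (submoduleP _ _) sM.
have [Ma|nMa] := pselect (M a); [by left|right].
pose I : set K := [set x | exists m c, [/\ M m, A c & x = m + a * c]].
have A0 := subring0 rA; have A1 := subring1 rA.
have M0 : M 0 by case/submoduleP: sM.
have idI : ideal A I.
  split; last first.
    move=> _ [m [c [Mm Ac ->]]]; apply: subringD => //; first exact: MA.
    exact: subringM.
  apply/submoduleP; split.
  - by exists 0, 0; split=> //; ring.
  - move=> _ _ [m [c [Mm Ac ->]]] [m' [c' [Mm' Ac' ->]]].
    exists (m - m'), (c - c'); split; last by ring.
      exact: MB.
    exact: subringB.
  - move=> d _ Ad [m [c [Mm Ac ->]]].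
    exists (d * m), (d * c); split; last by ring.
      exact: MZ.
    exact: subringM.
have [IA|/eqP IA] := pselect (I = A).
  have [m [c [Mm Ac onE]]] : I 1 by rewrite IA.
  have -> : b = b * m + c * (a * b) by rewrite -[LHS]mulr1 onE; ring.
  by apply: submoduleD sM _ _; exact: MZ.
exfalso; apply: nMa; rewrite -(Mmax I) //; first by exists 0, 1; split=> //; ring.
by move=> m Mm; exists m, 0; split=> //; ring.
Qed.

Lemma Max_not1 (K : fieldType) (A M : set K) :
  subring A -> Max A M -> ~ M 1.
Proof. by move=> rA [[idM /eqP MA] _] /(ideal_eq rA idM). Qed.

Lemma Max0 (K : fieldType) (A M : set K) : Max A M -> M 0.
Proof. by case=> -[[/submoduleP[]]]. Qed.

Lemma Max_sub (K : fieldType) (A M : set K) : Max A M -> M `<=` A.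
Proof. by case=> -[[]]. Qed.

Lemma notin_Max_neq0 (K : fieldType) (A M : set K) (s : K) :
  Max A M -> ~ M s -> s != 0.
Proof. by move=> /Max0 M0; apply: contra_notN => /eqP ->. Qed.

(** * Localizations at maximal ideals *)

Lemma sub_localization (K : fieldType) (A M : set K) :
  subring A -> Max A M -> A `<=` localization A M.
Proof.
move=> rA mM a Aa; exists a, 1; split=> //; rewrite ?divr1 //.
  exact: subring1.
exact: Max_not1 mM.
Qed.

Lemma localization_subring (K : fieldType) (A M : set K) :
  subring A -> Max A M -> subring (localization A M).
Proof.
move=> rA mM.
have nMM s t : A s -> A t -> ~ M s -> ~ M t -> ~ M (s * t).
  by move=> As At nMs nMt /(Max_prime rA mM As At)[].
apply/subringP; split.
- exact: sub_localization (subring1 rA).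
- move=> _ _ [a [s [Aa As nMs ->]]] [b [t [Ab At nMt ->]]].
  have [s0 t0] := (notin_Max_neq0 mM nMs, notin_Max_neq0 mM nMt).
  exists (a * t - b * s), (s * t); split; last by field; rewrite s0 t0.
  + by apply: subringB => //; exact: subringM.
  + exact: subringM.
  + exact: nMM.
- move=> _ _ [a [s [Aa As nMs ->]]] [b [t [Ab At nMt ->]]].
  have [s0 t0] := (notin_Max_neq0 mM nMs, notin_Max_neq0 mM nMt).
  exists (a * b), (s * t); split; last by field; rewrite s0 t0.
  + exact: subringM.
  + exact: subringM.
  + exact: nMM.
Qed.

Lemma unit_localization (K : fieldType) (A M : set K) (a s : K) :
  subring A -> Max A M -> A a -> A s -> ~ M a -> ~ M s ->
  unit_in (localization A M) (a / s).
Proof.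
move=> rA mM Aa As nMa nMs.
have [a0 s0] := (notin_Max_neq0 mM nMa, notin_Max_neq0 mM nMs).
split; first by rewrite mulf_neq0 ?invr_eq0.
  by exists a, s.
by exists s, a; rewrite invf_div.
Qed.

Lemma localization_local (K : fieldType) (A M : set K) :
  subring A -> Max A M -> local (localization A M).
Proof.
move=> rA mM _ [a [s [Aa As nMs ->]]].
have [Ma|nMa] := pselect (M a); last by left; exact: unit_localization.
right; have s0 := notin_Max_neq0 mM nMs.
have -> : 1 - a / s = (s - a) / s by field.
apply: unit_localization => //; first exact: subringB.
move=> Msa; apply: nMs; rewrite -(subrK a s).
by case: mM => -[[sM _] _] _; exact: submoduleD sM _ _.
Qed.

Lemma Max_sub_nonunits (K : fieldType) (A M : set K) :
  subring A -> Max A M -> M `<=` nonunits (localization A M).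
Proof.
move=> rA mM m Mm; have Am := Max_sub mM Mm.
split; first exact: sub_localization.
case=> m0 _ [a [s [Aa As nMs ms]]]; apply: nMs.
have s0 : s != 0.
  by apply: contraTneq m0 => s0; rewrite -invr_eq0 ms s0 invr0 mulr0 eqxx.
have -> : s = a * m by rewrite -(divfK s0 a) -ms mulrAC mulVf ?mul1r.
by case: mM => -[[/submoduleP[_ _ MZ] _] _] _; exact: MZ.
Qed.

(** For B quasi-local the right-hand side says that the maximal ideal of B lies
    over a prime contained in M; this is how h-locality singles out M. *)
Lemma localization_subP (K : fieldType) (A B M : set K) :
  subring A -> subring B -> A `<=` B -> Max A M ->
  localization A M `<=` B <-> A `&` nonunits B `<=` M.
Proof.
move=> rA rB AB mM; split=> [MB a [Aa [Ba na]]|NM _ [a [s [Aa As nMs ->]]]].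
  apply: contrapT => nMa; apply: na; split=> //; first exact: notin_Max_neq0 mM nMa.
  by apply: MB; exists 1, a; split=> //; [exact: subring1|rewrite div1r].
apply: subringM => //; first exact: AB.
have [[]|ns] := pselect (unit_in B s) => //.
by exfalso; apply: nMs; apply: NM; split=> //; split=> //; exact: AB.
Qed.

(** M is recovered from its localization as the trace of the nonunits. *)
Lemma localization_inj (K : fieldType) (A M M' : set K) :
  subring A -> Max A M -> Max A M' -> localization A M = localization A M' -> M = M'.
Proof.
move=> rA mM mM' locE.
have rM' := localization_subring rA mM'.
have NM' : A `&` nonunits (localization A M') `<=` M'.
  by apply/(localization_subP rA rM' (sub_localization rA mM') mM').
have [_ M'max] := mM; apply/esym/M'max; first by case: mM'.
move=> m Mm; apply: NM'; split; first exact: Max_sub mM _ Mm.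
by rewrite -locE; exact: Max_sub_nonunits.
Qed.

Lemma contraction_prime (K : fieldType) (A B : set K) :
  subring A -> subring B -> local B -> A `<=` B -> prime_ideal A (A `&` nonunits B).
Proof.
move=> rA rB lB AB.
have [/submoduleP[N0 NB NZ] _] := nonunits_ideal rB lB.
split.
- split; last by move=> x [].
  apply/submoduleP; split.
  + by split; [exact: subring0|].
  + by move=> x y [Ax Nx] [Ay Ny]; split; [exact: subringB|exact: NB].
  + by move=> a x Aa [Ax Nx]; split; [exact: subringM|apply: NZ => //; exact: AB].
- apply/eqP => NA; have : (A `&` nonunits B) 1 by rewrite NA; exact: subring1.
  by case=> _ [_]; apply; exact: unit_in1.
- move=> a b Aa Ab [_ [_ nab]].
  have [ua|na] := pselect (unit_in B a); last by left; do 2!split=> //; exact: AB.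
  right; do 2!split=> //; first exact: AB.
  by move=> ub; apply: nab; exact: unit_inM.
Qed.

(** All nonzero elements of A are units of B, hence B contains all fractions. *)
Lemma contraction_eq0 (K : fieldType) (A B : set K) :
  has_quotient_field A -> subring B -> A `<=` B ->
  A `&` nonunits B = [set 0] -> B = setT.
Proof.
move=> fA rB AB NA0; apply/seteqP; split=> // x _.
have [a [b [Aa Ab b0 ->]]] := fA x.
apply: subringM => //; first exact: AB.
have [[]|nb] := pselect (unit_in B b) => //; exfalso.
have : (A `&` nonunits B) b by do 2!split=> //; exact: AB.
by rewrite NA0 => /= /eqP; exact/negP.
Qed.

(** * Overrings of GMPD domains *)

Lemma setT_subring (K : fieldType) : subring [set: K].
Proof. by apply/subringP; split. Qed.

Lemma setT_local (K : fieldType) : local [set: K].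
Proof.
move=> x _; have [->|x0] := eqVneq x 0; last by left.
by right; rewrite subr0; split=> //; exact: oner_neq0.
Qed.

Lemma sub_has_quotient_field (K : fieldType) (A B : set K) :
  A `<=` B -> has_quotient_field A -> has_quotient_field B.
Proof.
move=> AB fA x; have [a [b [Aa Ab b0 ->]]] := fA x.
by exists a, b; split=> //; exact: AB.
Qed.

Lemma GMPD_overring_local (K : fieldType) (D B M : set K) :
  subring D -> has_quotient_field D -> GMPD D -> Max D M ->
  overrings (localization D M) B -> local B.
Proof.
move=> rD fD [_ gD] mM [rB MB].
apply: overring_local (localization_local rD mM) _ (gD M mM) rB MB.
  exact: localization_subring.
exact: sub_has_quotient_field (sub_localization rD mM) fD.
Qed.

Lemma overrings_localization_sub (K : fieldType) (D M : set K) :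
  subring D -> Max D M -> overrings (localization D M) `<=` overrings D.
Proof.
move=> rD mM B [rB MB]; split=> //; apply: subset_trans MB.
exact: sub_localization.
Qed.

(** The prime of D below the maximal ideal of B is contained in M and in M'. *)
Lemma overrings_localizationI (K : fieldType) (D B M M' : set K) :
  subring D -> has_quotient_field D -> GMPD D -> Max D M -> Max D M' ->
  overrings (localization D M) B -> overrings (localization D M') B ->
  B != setT -> M = M'.
Proof.
move=> rD fD gD mM mM' oB oB' /eqP BT.
have lB := GMPD_overring_local rD fD gD mM oB.
have [rB DB] := overrings_localization_sub rD mM oB.
have PM := proj1 (localization_subP rD rB DB mM) (proj2 oB).
have PM' := proj1 (localization_subP rD rB DB mM') (proj2 oB').
have [[_ hD] _] := gD.
have [|N [_ Nuniq]] := hD _ (contraction_prime rD rB lB DB).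
  by apply/eqP => /(contraction_eq0 fD rB DB).
by rewrite -(Nuniq M) // -(Nuniq M').
Qed.

Lemma ql_overringsE (K : fieldType) (D : set K) :
  subring D -> has_quotient_field D -> GMPD D ->
  ql_overrings D =
    setT |` \bigcup_(M in Max D) (overrings (localization D M) `\ setT).
Proof.
move=> rD fD gD; apply/seteqP; split=> B.
  move=> [[rB DB] /(quasi_localP rB) lB].
  have [->|BT] := pselect (B = setT); [by left|right].
  have [[_ hD] _] := gD.
  have [|M [[mM PM] _]] := hD _ (contraction_prime rD rB lB DB).
    by apply/eqP => /(contraction_eq0 fD rB DB).
  by exists M => //; split=> //; split=> //; exact/(localization_subP rD rB DB mM).
case=> [->|[M mM [oB _]]].
  split; first by split=> //; exact: setT_subring.
  by apply/(quasi_localP (@setT_subring K)); exact: setT_local.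
have oDB := overrings_localization_sub rD mM oB; split=> //.
by apply/(quasi_localP (proj1 oB)); exact: GMPD_overring_local mM oB.
Qed.

(** * Counting *)

Lemma nb_elements_setU1 (T : choiceType) (x : T) (S : set T) :
  finite_set S -> ~ S x -> nb_elements (x |` S) = (nb_elements S).+1.
Proof.
by move=> fS Sx; rewrite /nb_elements fset_setU1 // cardfsU1 in_fset_set // memNset.
Qed.

(** Double counting of the pairs (i, x) with x in F i. *)
Lemma nb_elements_bigcup (I T : choiceType) (S : set I) (F : I -> set T) :
  finite_set S -> finite_set (\bigcup_(i in S) F i) ->
  (forall i j x, S i -> S j -> F i x -> F j x -> i = j) ->
  nb_elements (\bigcup_(i in S) F i) = (\sum_(i <- fset_set S) nb_elements (F i))%N.
Proof.
move=> fS fU disj; set U := \bigcup_(i in S) F i.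
have fF i : S i -> finite_set (F i).
  by move=> Si; apply: sub_finite_set fU => x Fx; exists i.
have Fcard i : S i ->
    nb_elements (F i) = (\sum_(x <- fset_set U) (x \in F i : nat))%N.
  move=> Si; rewrite /nb_elements card_fset_sum1 -(fsbig_finite addn) //; last exact: fF.
  have {1}-> : F i = U `&` F i.
    by apply/seteqP; split=> [x Fx|x []//]; split=> //; exists i.
  by rewrite fsbig_mkcondr fsbig_finite.
rewrite [RHS](eq_big_seq
    (fun i => \sum_(x <- fset_set U) (x \in F i : nat))%N); last first.
  by move=> i; rewrite in_fset_set // => /set_mem /Fcard.
rewrite exchange_big /= /nb_elements card_fset_sum1.
(* By disjointness each x is counted for exactly one index i. *)
apply: eq_big_seq => x; rewrite in_fset_set // => /set_mem[i Si Fix].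
rewrite -(fsbig_finite addn) // (fsbigD1 i) //= mem_set // fsbig1 // => j [Sj /= ji].
by apply/eqP; rewrite eqb0; apply/negP => /set_mem Fjx; apply: ji; exact: disj Fjx Fix.
Qed.

Theorem lemma6 (K : fieldType) (D : set K) (D_subring : subring D)
    (D_frac : has_quotient_field D) (D_GMPD : GMPD D)
    (D_fin : finite_set (overrings D)) :
  (nb_elements (ql_overrings D))%:Z =
    \sum_(M \in Max D) (nb_elements (overrings (localization D M)))%:Z
    - (nb_elements (Max D))%:Z + 1.
Proof.
pose F M := overrings (localization D M) `\ setT.
have fin_over M : Max D M -> finite_set (overrings (localization D M)).
  by move=> mM; apply: sub_finite_set D_fin; exact: overrings_localization_sub.
have fin_Max : finite_set (Max D).
  have /inj_card_eq/eq_finite_set <- : {in Max D &, injective (localization D)}.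
    by move=> M M' /set_mem mM /set_mem mM'; exact: localization_inj.
  apply: sub_finite_set D_fin => _ [M mM <-].
  by split; [exact: localization_subring|exact: sub_localization].
have fin_U : finite_set (\bigcup_(M in Max D) F M).
  apply: sub_finite_set D_fin => B [M mM [oB _]].
  exact: overrings_localization_sub oB.
have nb_over M : Max D M ->
    nb_elements (overrings (localization D M)) = (nb_elements (F M)).+1.
  move=> mM; rewrite -(@nb_elements_setU1 _ setT).
  - by rewrite setD1K //; split=> //; exact: setT_subring.
  - by apply: sub_finite_set (fin_over M mM) => B [].
  - by case=> _; exact.
rewrite ql_overringsE // nb_elements_setU1 //; last by case=> M _ [_]; exact.
rewrite nb_elements_bigcup //; last first.
  move=> M M' B mM mM' [oB BT] [oB' _].
  by apply: overrings_localizationI oB oB' _ => //; exact/eqP.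
rewrite fsbig_finite // (eq_big_seq (fun M => (nb_elements (F M))%:Z + 1)); last first.
  by move=> M; rewrite in_fset_set // => /set_mem /nb_over ->; rewrite -addn1 PoszD.
rewrite big_split /= -addn1 PoszD; congr (_ + _).
rewrite /nb_elements [X in _ - X%:Z]card_fset_sum1 !(big_morph Posz PoszD (erefl _)).
by rewrite addrK.
Qed.
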